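(* Let $\eta^{(4)}$ be the $4$-point correlation function of the balanced binary Rudin--Shapiro sequence and let $\eta_2$ be the autocorrelation function of the balanced binary sequence $v$ coming from the substitution $\varrho_2$ induced by the Rudin--Shapiro substitution on two-letter words. Then $$\eta^{(4)}(1,m,m+1)=\eta_2(m)\qquad\text{for all } m\in\mathbb{Z}.$$
   Context: The binary (balanced) Rudin--Shapiro sequence is any bi-infinite word $w=(w_i)_{i\in\mathbb{Z}}\in\{1,-1\}^{\mathbb{Z}}$ satisfying, for all $m\in\mathbb{Z}$, $w_{4m+\ell}=w_m$ for $\ell\in\{0,1\}$ and $w_{4m+\ell}=(-1)^{m+\ell}w_m$ for $\ell\in\{2,3\}$. Its $4$-point correlation function is $$\eta^{(4)}(m_1,m_2,m_3)=\lim_{N\to\infty}\frac{1}{2N+1}\sum_{i=-N}^{N}w_iw_{i+m_1}w_{i+m_2}w_{i+m_3};$$ the limits exist and do not depend on the choice of $w$. The substitution $\varrho_2$ on $\{A,B,C,D\}$ is $A\mapsto BC$, $B\mapsto BD$, $C\mapsto AD$, $D\mapsto AC$. The sequence $v=(v_i)_{i\in\mathbb{Z}}\in\{1,-1\}^{\mathbb{Z}}$ is obtained from a bi-infinite fixed point of $\varrho_2^2$ by the coding $A,C\mapsto 1$, $B,D\mapsto-1$; explicitly, for all $m\in\mathbb{Z}$, $$v_{4m}=-1,\quad v_{4m+1}=(-1)^{m+1},\quad v_{4m+2}=1,\quad v_{4m+3}=(-1)^{m+1}v_m.$$ Its autocorrelation function is $\eta_2(k)=\lim_{N\to\infty}\frac{1}{2N+1}\sum_{i=-N}^{N}v_iv_{i+k}$,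 $k\in\mathbb{Z}$. (The hull of $v$ is a topological factor of the Rudin--Shapiro hull.) *)

(* Defs.v *)
From HB Require Import structures.
From mathcomp Require Import all_boot all_order all_algebra.
From mathcomp Require Import boolp classical_sets reals topology normedtype sequences.

Set Implicit Arguments.
Unset Strict Implicit.
Unset Printing Implicit Defensive.

Import Order.TTheory GRing.Theory Num.Theory.
Import numFieldNormedType.Exports.

Local Open Scope classical_set_scope.
Local Open Scope ring_scope.

(* A bi-infinite word over an alphabet [X] is a function [int -> X]. *)

Definition rudin_shapiro (w : int -> int) : Prop :=
  (forall i : int, w i = 1 \/ w i = -1) /\
  (forall m : int,
     [/\ w (4 * m) = w m,
         w (4 * m + 1) = w m,
         w (4 * m + 2) = (-1) ^ (m + 2) * w m &
         w (4 * m + 3) = (-1) ^ (m + 3) * w m]).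

Inductive letter : Type := LA | LB | LC | LD.

Definition rho2 (a : letter) : letter * letter :=
  match a with
  | LA => (LB, LC)
  | LB => (LB, LD)
  | LC => (LA, LD)
  | LD => (LA, LC)
  end.

(* The action of rho2 on bi-infinite words: since rho2 has constant length 2,
   the image of the letter at position m occupies positions 2m and 2m+1.
   [divz] rounds down for the divisor 2, so negative positions are treated
   correctly and the origin of the image is the first letter of
   [rho2 (x 0)]. *)
Definition rho2_word (x : int -> letter) : int -> letter :=
  fun i => let p := rho2 (x (i %/ 2)%Z) in
           if (i %% 2)%Z == 0 then p.1 else p.2.

Definition rho2_sq_fixed (x : int -> letter) : Prop :=
  forall i : int, rho2_word (rho2_word x) i = x i.

Definition coding (a : letter) : int :=
  match a with
  | LA | LC => 1
  | LB | LD => -1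
  end.

Definition rho2_sequence (v : int -> int) : Prop :=
  exists x : int -> letter,
    rho2_sq_fixed x /\ (forall i : int, v i = coding (x i)).

(* [sym_avg R f N] is (f(-N) + ... + f(N)) / (2N+1), the summation index i
   being written as j - N with 0 <= j <= 2N. *)
Definition sym_avg (R : realType) (f : int -> int) : R ^nat :=
  fun N => (\sum_(0 <= j < (2 * N).+1) f (j%:Z - N%:Z))%:~R
           / ((2 * N).+1)%:R.

Definition corr4_avg (R : realType) (w : int -> int) (m1 m2 m3 : int) : R ^nat :=
  sym_avg R (fun i => w i * w (i + m1) * w (i + m2) * w (i + m3)).

Definition corr2_avg (R : realType) (v : int -> int) (k : int) : R ^nat :=
  sym_avg R (fun i => v i * v (i + k)).

(* [limn] is a total operator: these values are meaningful only together with
   the convergence of the averages. *)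
Definition eta4 (R : realType) (w : int -> int) (m1 m2 m3 : int) : R :=
  limn (corr4_avg R w m1 m2 m3).

Definition eta2 (R : realType) (v : int -> int) (k : int) : R :=
  limn (corr2_avg R v k).

(* Main.v *)
(** The words [u i = w i * w (i + 1)] and [-v] satisfy the same recursion
    [u (4m) = 1], [u (4m+1) = (-1)^m], [u (4m+2) = -1],
    [u (4m+3) = (-1)^(m+1) u m].
    Unfolding it [k] times determines [u] on all [i] with [4^k] not dividing
    [i + 1], where it has period [2 * 4^k]. Hence the sum of [u i * u (i + m)]
    over any window of that length is within 8 of a constant depending only on
    [k] and [m]. As [k] grows, both sequences of averages are trapped around
    common centres, so they are Cauchy with the same limit. *)

Require Import Defs.
From HB Require Import structures.
From mathcomp Require Import all_boot all_order all_algebra.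
From mathcomp Require Import boolp classical_sets reals topology normedtype sequences.
From mathcomp Require Import zify ring lra.

Import Order.TTheory GRing.Theory Num.Theory.
Import numFieldNormedType.Exports.

Local Open Scope classical_set_scope.
Local Open Scope ring_scope.

(** * The recursion shared by the two words *)

Definition sgn_parity (m : int) : int := if (m %% 2)%Z == 0 then 1 else -1.

Lemma expN1zE (m : int) : (-1) ^ m = sgn_parity m :> int.
Proof.
rewrite /sgn_parity {1}(divz_eq m 2) exprzDr ?unitrN1 // [(m %/ 2)%Z * 2]mulrC -exprz_exp.
rewrite (_ : (-1 : int) ^ (2 : int) = 1) // exp1rz mul1r.
have : (m %% 2)%Z = 0 \/ (m %% 2)%Z = 1 by lia.
by case=> ->; rewrite ?expr0z ?expr1z.
Qed.

(** Only positions [4 * m + 3] refer back to [u]. The value at -1 stays free, since there the rule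
    reads [u (-1) = u (-1)]. *)
Definition toeplitz_word (u : int -> int) : Prop :=
  (forall i, `|u i| <= 1) /\
  (forall m : int,
     [/\ u (4 * m) = 1, u (4 * m + 1) = sgn_parity m,
         u (4 * m + 2) = -1 & u (4 * m + 3) = - sgn_parity m * u m]).

(** Inside a block of four, [w m] occurs twice and squares to 1, leaving a sign. The product at
    [4 * m + 3] straddles two blocks and keeps [w m * w (m + 1)]. *)
Lemma rudin_shapiro_toeplitz (w : int -> int) :
  rudin_shapiro w -> toeplitz_word (fun i => w i * w (i + 1)).
Proof.
move=> [wpm wE]; split=> [i|m].
  by case: (wpm i) => ->; case: (wpm (i + 1)) => ->.
have [w0 w1 w2 w3] := wE m; have [w4 _ _ _] := wE (m + 1).
have -> : 4 * m + 1 + 1 = 4 * m + 2 by lia.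
have -> : 4 * m + 2 + 1 = 4 * m + 3 by lia.
have -> : 4 * m + 3 + 1 = 4 * (m + 1) by lia.
rewrite w0 w1 w2 w3 w4 !expN1zE.
have -> : sgn_parity (m + 2) = sgn_parity m by rewrite /sgn_parity; do !case: eqP; lia.
have -> : sgn_parity (m + 3) = - sgn_parity m by rewrite /sgn_parity; do !case: eqP; lia.
split; rewrite ?mulrA //.
- by case: (wpm m) => ->.
- by case: (wpm m) => ->; rewrite /sgn_parity; case: eqP.
- by case: (wpm m) => ->; rewrite /sgn_parity; case: eqP.
Qed.

Lemma rho2_sequence_toeplitz (v : int -> int) :
  rho2_sequence v -> toeplitz_word (fun i => - v i).
Proof.
move=> [x [xfix vE]]; split=> [i|m]; first by rewrite vE; case: (x i).
have xE i : x i = let p := rho2 (x (i %/ 4)%Z) in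
  let q := rho2 (if ((i %/ 2)%Z %% 2)%Z == 0 then p.1 else p.2) in
  if (i %% 2)%Z == 0 then q.1 else q.2.
  rewrite -{1}xfix /rho2_word /=.
  by have -> : ((i %/ 2)%Z %/ 2)%Z = (i %/ 4)%Z by lia.
(* Images under [rho2] start with A or B and end with C or D, so the letter at [m] reveals the
   parity of [m]; this produces the sign [sgn_parity m]. *)
have xpar : if (m %% 2)%Z == 0 then x m = LA \/ x m = LB else x m = LC \/ x m = LD.
  rewrite -xfix; move: (rho2_word x) => y; rewrite /rho2_word.
  by case: (_ == _); case: (y _); [right|right|left|left|left|right|right|left].
have x4 (r : int) : 0 <= r < 4 -> x (4 * m + r) = let p := rho2 (x m) in
  let q := rho2 (if (r %/ 2)%Z == 0 then p.1 else p.2) in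
  if (r %% 2)%Z == 0 then q.1 else q.2.
  move=> r4; rewrite xE.
  have -> : ((4 * m + r) %/ 4)%Z = m by lia.
  have -> : (((4 * m + r) %/ 2)%Z %% 2)%Z = (r %/ 2)%Z by lia.
  by have -> : ((4 * m + r) %% 2)%Z = (r %% 2)%Z by lia.
rewrite -{1}[4 * m]addr0 !vE !x4 //= /sgn_parity.
by case: ifP xpar => _ [] ->.
Qed.

(** * Periodic approximants *)

(* The value 0 at depth 0 is a placeholder for the positions left undetermined
   by the recursion, those with [4 ^ k] dividing [i + 1]. *)
Fixpoint toeplitz_approx (k : nat) (i : int) : int :=
  if k is k'.+1 then
    let m := (i %/ 4)%Z in
    if (i %% 4)%Z == 0 then 1
    else if (i %% 4)%Z == 1 then sgn_parity m
    else if (i %% 4)%Z == 2 then -1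
    else - sgn_parity m * toeplitz_approx k' m
  else 0.

Lemma toeplitz_approx_le1 (k : nat) (i : int) : `|toeplitz_approx k i| <= 1.
Proof.
elim: k i => [|k IHk] i //=; have := IHk (i %/ 4)%Z.
by rewrite /sgn_parity; do ! case: eqP => _; lia.
Qed.

(** The factor 2 keeps the induced shift of [i %/ 4] even at every depth, so the signs [sgn_parity]
    are preserved. *)
Lemma toeplitz_approx_periodic (k : nat) (i : int) :
  toeplitz_approx k (i + (2 * 4 ^ k)%N%:Z) = toeplitz_approx k i.
Proof.
elim: k i => [|k IHk] i //=.
have -> : ((i + (2 * 4 ^ k.+1)%N%:Z) %/ 4)%Z = (i %/ 4)%Z + (2 * 4 ^ k)%N%:Z.
  by rewrite expnS; lia.
have -> : ((i + (2 * 4 ^ k.+1)%N%:Z) %% 4)%Z = (i %% 4)%Z by rewrite expnS; lia.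
rewrite IHk.
by have -> : sgn_parity ((i %/ 4)%Z + (2 * 4 ^ k)%N%:Z) = sgn_parity (i %/ 4)%Z
  by rewrite /sgn_parity; do !case: eqP; lia.
Qed.

Lemma toeplitz_approx_eq (u : int -> int) (k : nat) (i : int) :
  toeplitz_word u -> ~~ ((4 ^ k)%N%:Z %| i + 1)%Z -> u i = toeplitz_approx k i.
Proof.
move=> [_ uE]; elim: k i => [|k IHk] i; first by rewrite dvd1z.
have [u0 u1 u2 u3] := uE (i %/ 4)%Z.
have iE := divz_eq i 4; rewrite mulrC in iE.
rewrite /=; case: eqP => [r0 _|r0]; first by rewrite {1}iE r0 addr0.
case: eqP => [r1 _|r1]; first by rewrite {1}iE r1.
case: eqP => [r2 _|r2]; first by rewrite {1}iE r2.
have r3 : (i %% 4)%Z = 3 by lia.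
(* With [m = i %/ 4] one has [i + 1 = 4 * (m + 1)], so [4 ^ k] dividing [m + 1] would make
   [4 ^ k.+1] divide [i + 1]. *)
move=> ndiv; rewrite {1}iE r3 u3 IHk //; apply: contra ndiv => /dvdzP[q qE].
by apply/dvdzP; exists q; rewrite expnS; lia.
Qed.

(** * Sums over windows of consecutive integers *)

Lemma window_sum_shift (p : int -> int) (P : nat) (a b : int) :
  (forall i, p (i + P%:Z) = p i) ->
  \sum_(0 <= j < P) p (a + j%:Z) = \sum_(0 <= j < P) p (b + j%:Z).
Proof.
move=> pP.
(* Moving the window by one trades [p c] for the equal value [p (c + P)]. *)
have step c : \sum_(0 <= j < P) p (c + 1 + j%:Z) = \sum_(0 <= j < P) p (c + j%:Z).
  case: P pP => [|P] pP; first by rewrite !big_geq.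
  rewrite big_nat_recr //= [RHS]big_nat_recl //= addr0 addrC.
  have -> : c + 1 + P%:Z = c + P.+1%:Z by lia.
  rewrite pP; congr (_ + _); apply: eq_bigr => j _; congr p; lia.
suff to0 c : \sum_(0 <= j < P) p (c + j%:Z) = \sum_(0 <= j < P) p (0 + j%:Z).
  by rewrite to0 [RHS]to0.
elim/int_rect: c => [//|n IHn|n IHn].
  by rewrite -IHn -(step n%:Z); apply: eq_bigr => j _; congr p; lia.
by rewrite -IHn -(step (- n.+1%:Z)); apply: eq_bigr => j _; congr p; lia.
Qed.

Lemma window_sum_dvd (d : nat) (a : int) : (0 < d)%N ->
  \sum_(0 <= j < 2 * d) (d%:Z %| a + j%:Z)%Z%:Z = 2 :> int.
Proof.
move=> d0.
have per i : (d%:Z %| i + d%:Z)%Z%:Z = (d%:Z %| i)%Z%:Z :> int.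
  by rewrite rpredDr ?dvdzz.
have one c : \sum_(0 <= j < d) (d%:Z %| c + j%:Z)%Z%:Z = 1 :> int.
  (* The indicator of the multiples of [d] is [d]-periodic, so the window may start at 0, where only
     [j = 0] counts. *)
  rewrite (@window_sum_shift (fun i => (d%:Z %| i)%Z%:Z) d c 0 per).
  case: d d0 {per} => // d _; rewrite big_nat_recl // addr0 dvdz0 big_nat big1 //.
  by move=> j /andP[_ jd]; rewrite add0r dvdzE /= gtnNdvd.
rewrite (@big_cat_nat _ _ _ d) //=; last lia.
rewrite one -{1}[d]add0n big_addn (_ : (2 * d - d = d)%N); last lia.
rewrite (eq_bigr (fun j => (d%:Z %| (a + d%:Z) + j%:Z)%Z%:Z)) ?one //.
by move=> j _; rewrite PoszD addrAC addrA.
Qed.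

Lemma window_sum_le (f : int -> int) (L : nat) (a : int) :
  (forall i, `|f i| <= 1) -> `|\sum_(0 <= j < L) f (a + j%:Z)| <= L%:Z.
Proof.
move=> f1; elim: L => [|L IHL]; first by rewrite big_geq.
rewrite big_nat_recr //= -addn1 PoszD.
by apply: le_trans (ler_normD _ _) _; apply: lerD.
Qed.

Lemma window_sum_cat (f : int -> int) (L M : nat) (a : int) :
  \sum_(0 <= j < L + M) f (a + j%:Z) =
  \sum_(0 <= j < L) f (a + j%:Z) + \sum_(0 <= j < M) f (a + L%:Z + j%:Z).
Proof.
rewrite (@big_cat_nat _ _ _ L) //=; last lia.
congr (_ + _); rewrite -{1}[L]add0n big_addn addKn.
by apply: eq_bigr => j _; congr f; lia.
Qed.

(** Cut the window into [L %/ P] full blocks, each with error at most [c], and fewer than [P]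
    leftover terms, which cost the part independent of [L]. Multiplying by [P] keeps everything in
    the integers. *)
Lemma window_sum_near (f : int -> int) (P : nat) (S c : int) :
  (0 < P)%N -> (forall i, `|f i| <= 1) ->
  (forall a, `|\sum_(0 <= j < P) f (a + j%:Z) - S| <= c) ->
  forall (L : nat) (a : int),
    `|P%:Z * \sum_(0 <= j < L) f (a + j%:Z) - L%:Z * S| <=
    L%:Z * c + P%:Z * (P%:Z + `|S|).
Proof.
move=> P0 f1 fS L a.
have c0 : 0 <= c by apply: le_trans (fS 0).
have blocks q : `|\sum_(0 <= j < q * P) f (a + j%:Z) - q%:Z * S| <= q%:Z * c.
  elim: q => [|q IHq]; first by rewrite big_geq // !mul0r.
  rewrite mulSnr window_sum_cat -addn1 PoszD !mulrDl !mul1r opprD addrACA.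
  by apply: le_trans (ler_normD _ _) _; apply: lerD.
have := divn_eq L P; set q := (L %/ P)%N; set r := (L %% P)%N => LE.
have rP : (r < P)%N by rewrite ltn_mod.
rewrite {1}LE window_sum_cat.
have := blocks q; have := window_sum_le _ r (a + (q * P)%N%:Z) f1.
set A := bigop _ _ _; set B := bigop _ _ _ => Br Aq.
have -> : P%:Z * (B + A) - L%:Z * S = P%:Z * (B - q%:Z * S) + (P%:Z * A - r%:Z * S).
  by rewrite LE PoszD PoszM; ring.
apply: le_trans (ler_normD _ _) _; apply: lerD.
  rewrite normrM; apply: (@le_trans _ _ (P%:Z * (q%:Z * c))).
    by apply: ler_wpM2l.
  by rewrite mulrA; apply: ler_wpM2r => //; lia.
apply: le_trans (ler_normB _ _) _; rewrite !normrM mulrDr; apply: lerD.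
  by apply: ler_wpM2l => //; lia.
by apply: ler_wpM2r => //; lia.
Qed.

(** * Correlations compared with the periodic centres *)

Definition approx_corr_sum (k : nat) (m : int) : int :=
  \sum_(0 <= j < 2 * 4 ^ k)
    toeplitz_approx k (0 + j%:Z) * toeplitz_approx k (0 + j%:Z + m).

(** A term can differ from its approximant only if [4 ^ k] divides [a + j + 1] or [a + j + m + 1].
    Each occurs for two values of [j], and a changed product moves by at most 2: hence
    [2 * 2 + 2 * 2 = 8]. *)
Lemma toeplitz_corr_window (u : int -> int) (m : int) (k : nat) (a : int) :
  toeplitz_word u ->
  `|\sum_(0 <= j < 2 * 4 ^ k) u (a + j%:Z) * u (a + j%:Z + m)
    - approx_corr_sum k m| <= 8.
Proof.
move=> hu; have [u1 _] := hu.
pose t := toeplitz_approx k.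
(* Periodicity moves the approximant's window from 0 to [a], so the two sums can be compared term by
   term. *)
rewrite /approx_corr_sum -(@window_sum_shift (fun i => t i * t (i + m)) _ a); last first.
  by move=> i; rewrite /t addrAC !toeplitz_approx_periodic.
rewrite -sumrB; apply: le_trans (ler_norm_sum _ _ _) _.
pose ind c j : int := ((4 ^ k)%N%:Z %| c + j%:Z)%Z%:Z.
apply: (@le_trans _ _ (\sum_(0 <= j < 2 * 4 ^ k)
    (2 * ind (a + 1)%R j + 2 * ind (a + m + 1)%R j))).
  apply: ler_sum => j _; rewrite /ind.
  have ut i : ~~ ((4 ^ k)%N%:Z %| i + 1)%Z -> u i = t i by apply: toeplitz_approx_eq.
  have := ut (a + j%:Z); have := ut (a + j%:Z + m).
  have -> : a + j%:Z + m + 1 = a + m + 1 + j%:Z by lia.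
  have -> : a + j%:Z + 1 = a + 1 + j%:Z by lia.
  have le1 (x y x' y' : int) : `|x| <= 1 -> `|y| <= 1 -> `|x'| <= 1 -> `|y'| <= 1 ->
      `|x * y - x' * y'| <= 2.
    move=> hx hy hx' hy'; apply: le_trans (ler_normB _ _) _; rewrite !normrM.
    by apply: le_trans (lerD (y := 1) (t := 1) _ _) _ => //; apply: mulr_ile1.
  have bnd := le1 _ _ _ _ (u1 (a + j%:Z)) (u1 (a + j%:Z + m))
    (toeplitz_approx_le1 k (a + j%:Z)) (toeplitz_approx_le1 k (a + j%:Z + m)).
  case: (_ %| a + m + 1 + _)%Z => /= h1; case: (_ %| a + 1 + _)%Z => /= h2; try exact: le_trans bnd _.
  by rewrite h1 // h2 // subrr.
have d0 : (0 < 4 ^ k)%N by rewrite expn_gt0.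
by rewrite big_split -!mulr_sumr /= /ind !window_sum_dvd.
Qed.

Lemma toeplitz_avg_near (R : realType) (u : int -> int) (m : int) (k : nat) (eps : R) :
  toeplitz_word u -> 8 / (2 * 4 ^ k)%N%:R < eps ->
  \forall N \near \oo,
    `|(approx_corr_sum k m)%:~R / (2 * 4 ^ k)%N%:R
      - corr2_avg R u m N| < eps.
Proof.
move=> hu; have [u1 _] := hu.
set S := approx_corr_sum k m; set P := (2 * 4 ^ k)%N => Peps.
have P0 : (0 < P)%N by rewrite muln_gt0 expn_gt0.
have P0R : 0 < P%:R :> R by rewrite ltr0n.
have f1 i : `|u i * u (i + m)| <= 1 by rewrite normrM mulr_ile1.
have near_sum := @window_sum_near (fun i => u i * u (i + m)) P S 8 P0 f1
  (fun a => toeplitz_corr_window u m k a hu).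
pose C : R := (P%:Z * (P%:Z + `|S|))%:~R.
have d0 : 0 < eps - 8 / P%:R by rewrite subr_gt0.
have C0 : 0 <= C by rewrite ler0z mulr_ge0 // addr_ge0.
near=> N.
set L := (2 * N).+1.
have L0R : 0 < L%:R :> R by rewrite ltr0n.
(* Dividing [near_sum] by [P * L] leaves the error [8 / P + C / (P * L)]. As [C] does not depend on
   [N], a large [N] fits the second term into the gap [eps - 8 / P]. *)
have CL : C / (eps - 8 / P%:R) < L%:R.
  apply: (@lt_le_trans _ _ N%:R); last by rewrite ler_nat /L; lia.
  by near: N; exact: nbhs_infty_gtr.
have avgE : corr2_avg R u m N =
    (\sum_(0 <= j < L) u (- N%:Z + j%:Z) * u (- N%:Z + j%:Z + m))%:~R / L%:R.
  rewrite /corr2_avg /sym_avg; congr (_%:~R / _); apply: eq_bigr => j _.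
  by rewrite [- _ + _]addrC.
rewrite avgE; have := near_sum L (- N%:Z).
set T := bigop _ _ _ => hT.
have {hT} : `|P%:R * T%:~R - L%:R * S%:~R| <= L%:R * 8 + C :> R.
  move: hT; rewrite -(ler_int R) intr_norm intrB intrD -/C.
  by rewrite (intrM _ P%:Z) (intrM _ L%:Z S) (intrM _ L%:Z 8).
rewrite ltr_pdivrMr // in CL.
have -> : S%:~R / P%:R - T%:~R / L%:R =
    - (P%:R * T%:~R - L%:R * S%:~R) / (P%:R * L%:R) :> R.
  by field; rewrite ?lt0r_neq0.
rewrite mulNr normrN normrM normfV (gtr0_norm (mulr_gt0 P0R L0R)) => hT.
rewrite ltr_pdivrMr ?mulr_gt0 //.
apply: (le_lt_trans hT).
have P1 : 1 <= P%:R :> R by rewrite ler1n.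
(* Once 8 reads [8 / P * P], these terms cancel, and [C < L * e <= L * e * P] remains. *)
have e8 : 8 = 8 / P%:R * P%:R :> R by rewrite divfK ?lt0r_neq0.
rewrite [X in _ * X + _]e8; set e := eps - _ in CL d0.
have -> : eps = e + 8 / P%:R by rewrite /e subrK.
have : L%:R * e <= L%:R * e * P%:R by rewrite ler_peMr // mulr_ge0 ?ltW.
lra.
Unshelve. all: by end_near.
Qed.

(** * Existence and equality of the limits *)

Lemma cvg_common_centers (R : realType) (a b : R ^nat) :
  (forall eps : R, 0 < eps -> exists r,
     (\forall n \near \oo, `|r - a n| < eps) /\
     (\forall n \near \oo, `|r - b n| < eps)) ->
  [/\ cvgn a, cvgn b & limn a = limn b].
Proof.
move=> hab.
have ca : cvgn a.
  apply/cauchy_cvgP/cauchy_exP => eps eps0.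
  by have [r [ra _]] := hab eps eps0; exists r.
have cb : cvgn b.
  apply/cauchy_cvgP/cauchy_exP => eps eps0.
  by have [r [_ rb]] := hab eps eps0; exists r.
split=> //; apply/esym/(cvg_lim (@norm_hausdorff _ _)).
(* The centre [r] varies with [eps], so no limit value is at hand; instead [b = (b - a) + a], where
   [b - a] tends to 0 by the triangle inequality through [r]. *)
suff ab0 : (fun n => b n - a n) @ \oo --> (0 : R).
  rewrite (_ : b = fun n => b n - a n + a n); last by apply/funext => n; rewrite subrK.
  by rewrite -[limn a]add0r; apply: cvgD.
apply/cvgrPdist_lt => eps eps0.
have e20 : 0 < eps / 2 by rewrite divr_gt0.
have [r [ra rb]] := hab _ e20.
near=> n.
have -> : 0 - (b n - a n) = (r - b n) - (r - a n) by ring.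
apply: (le_lt_trans (ler_normB _ _)); rewrite [eps]splitr ltrD //.
  by near: n.
by near: n.
Unshelve. all: by end_near.
Qed.

Lemma toeplitz_corr_eq (R : realType) (u u' : int -> int) (m : int) :
  toeplitz_word u -> toeplitz_word u' ->
  [/\ cvgn (corr2_avg R u m), cvgn (corr2_avg R u' m) &
      limn (corr2_avg R u m) = limn (corr2_avg R u' m)].
Proof.
move=> hu hu'; apply: cvg_common_centers => eps eps0.
(* This gives [8 / eps < k <= 2 * 4 ^ k]; the resulting centre involves neither [u] nor [u'], so it
   serves both. *)
pose k := Num.bound (8 / eps).
exists ((approx_corr_sum k m)%:~R / (2 * 4 ^ k)%N%:R).
have keps : 8 / (2 * 4 ^ k)%N%:R < eps :> R.
  rewrite ltr_pdivrMr ?ltr0n ?muln_gt0 ?expn_gt0 // mulrC -ltr_pdivrMr //.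
  apply: (@lt_le_trans _ _ k%:R).
    by rewrite archi_boundP // divr_ge0 // ltW.
  by rewrite ler_nat; have := ltn_expl k (isT : (1 < 4)%N); lia.
by split; apply: toeplitz_avg_near.
Qed.

Theorem mainTheorem4 (R : realType) (w v : int -> int)
    (hw : rudin_shapiro w) (hv : rho2_sequence v) (m : int) :
  [/\ cvgn (corr4_avg R w 1 m (m + 1)),
      cvgn (corr2_avg R v m) &
      eta4 R w 1 m (m + 1) = eta2 R v m].
Proof.
have := @toeplitz_corr_eq R _ _ m (rudin_shapiro_toeplitz w hw) (rho2_sequence_toeplitz v hv).
(* The shifts 1, [m], [m + 1] pair up into the adjacent products at [i] and [i + m]. *)
have -> : corr2_avg R (fun i => w i * w (i + 1)) m = corr4_avg R w 1 m (m + 1).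
  by congr sym_avg; apply/funext => i; rewrite !mulrA addrA.
have -> : corr2_avg R (fun i => - v i) m = corr2_avg R v m.
  by congr sym_avg; apply/funext => i; rewrite mulrNN.
by [].
Qed.
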